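(* There exists a (randomized) online algorithm for the Machine Covering problem on $m$ identical parallel machines whose competitive ratio in the random-order model is $\tilde{O}(\sqrt[4]{m})$, i.e. $O(\sqrt[4]{m}\cdot \mathrm{polylog}(m))$.
   Context: Machine Covering: an input is a set $\mathcal{J}=\{J_1,\dots,J_n\}$ of jobs with non-negative sizes $p_1,\dots,p_n$, to be assigned to $m$ identical parallel machines; the load of a machine is the total size of jobs assigned to it, and the objective is to maximize the minimum machine load. $\mathrm{OPT}(\mathcal{J})$ denotes the optimal (offline) minimum load. In the online version jobs are revealed one by one and each must be assigned permanently to a machine before the next one is revealed; the algorithm knows $n$ in advance. In the random-order model the adversary chooses the input set $\mathcal{J}$, and the arrival order is a permutation $\sigma$ chosen uniformly at random from the symmetric group $S_n$. For an online algorithm $A$, let $A(\mathcal{J}^\sigma)$ be its (expected, if $A$ is randomized) minimum load on the order $\sigma$, and $A^{\mathrm{rom}}(\mathcal{J})=\mathbb{E}_{\sigma\sim S_n}[A(\mathcal{J}^\sigma)]$. The competitive ratio of $A$ in the random-order model is $\sup_{\mathcal{J}} \mathrm{OPT}(\mathcal{J})/A^{\mathrm{rom}}(\mathcal{J})$, with the conventions $0/0=1$ and $a/0=\infty$ for $a>0$. *)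

(* Defs.v *)
From HB Require Import structures.
From mathcomp Require Import all_boot all_order all_algebra all_fingroup.
From mathcomp Require Import all_classical all_reals.
From mathcomp Require Import ereal exp.

Set Implicit Arguments. Unset Strict Implicit. Unset Printing Implicit Defensive.
Import Order.TTheory GRing.Theory Num.Theory.
Local Open Scope ring_scope.

Section MachineCovering.
Variable R : realType.

(* A (behavioural) randomized online algorithm: knowing the number m of
   machines and the number n of jobs, given the history (sizes of the jobs
   revealed so far together with the machines they were assigned to) and the
   size of the current job, it outputs a probability distribution over the
   m machines for the current job. *)
Definition online_alg := forall m n : nat, seq (R * 'I_m) -> R -> 'I_m -> R.

Definition valid_alg (A : online_alg) : Prop :=
  forall (m n : nat) (h : seq (R * 'I_m)) (x : R), (0 < m)%N ->
    (forall j, 0 <= A m n h x j) /\ \sum_(j < m) A m n h x j = 1.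

Definition load (m n : nat) (s : n.-tuple R) (a : n.-tuple 'I_m) (j : 'I_m) : R :=
  \sum_(i < n | tnth a i == j) tnth s i.

(* minimum machine load (the neutral element, the total size, is an upper
   bound of every load, so for m >= 1 this is the true minimum) *)
Definition minload (m n : nat) (s : n.-tuple R) (a : n.-tuple 'I_m) : R :=
  \big[Num.min/ \sum_(i < n) tnth s i]_(j < m) load s a j.

Definition OPT (m n : nat) (p : n.-tuple R) : R :=
  \big[Num.max/0]_(a : n.-tuple 'I_m) minload p a.

Definition assign_prob (A : online_alg) (m n : nat) (s : n.-tuple R)
    (a : n.-tuple 'I_m) : R :=
  \prod_(i < n) A m n (zip (take i s) (take i a)) (tnth s i) (tnth a i).

Definition alg_value (A : online_alg) (m n : nat) (s : n.-tuple R) : R :=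
  \sum_(a : n.-tuple 'I_m) assign_prob A s a * minload s a.

Definition arrival (n : nat) (p : n.-tuple R) (sigma : 'S_n) : n.-tuple R :=
  [tuple tnth p (sigma i) | i < n].

Definition rom_value (A : online_alg) (m n : nat) (p : n.-tuple R) : R :=
  (n`!)%:R^-1 * \sum_(sigma : 'S_n) alg_value A m (arrival p sigma).

Definition ratio (a b : R) : \bar R :=
  if b == 0 then (if a == 0 then 1%E else +oo%E) else (a / b)%:E.

Definition rom_comp_ratio (A : online_alg) (m : nat) : \bar R :=
  ereal_sup [set r | exists (n : nat) (p : n.-tuple R),
     (forall i, 0 <= tnth p i) /\ r = ratio (OPT m p) (rom_value A m p)].

End MachineCovering.

(* Main.v *)
(* Let V be the optimum. Fix a number k of machines and a cutoff c. During the
   first half of the input (the sample) and for every later job of size at least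
   c, assign greedily among the machines of index >= k; assign the other jobs
   greedily among the first k machines. If at least m - k jobs have size >= c,
   greediness alone forces every machine of index >= k up to load c, whatever
   else was put there. If k is at most twice k0 = m - #{jobs >= c} and c <= V / 64,
   the jobs below c have volume at least k0 V, half of which typically arrives
   after the sample, and this fills the first k machines to c as well.

   So it suffices to guess k up to a factor 2 (log m guesses) and the scale of V.
   Plain greedy is good enough when m jobs have size >= V / (144 m^(1/4)).
   Otherwise sum the sampled jobs whose rank from the top is at least r, for a
   uniformly random r in a window of width O(sqrt m) around half of m. The sampled
   jobs below V / (144 m^(1/4)) have volume at least V / 6 and are small, so
   dropping any m^(1/4) of the largest of them keeps a constant fraction of that
   volume; by Chebyshev the number of larger sampled jobs lies in the window. Hence
   with probability of order m^(-1/4) the sum is within a factor poly(m) of V,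
   and V is guessed among O(log m) multiples of it. *)

Require Import Defs.
From HB Require Import structures.
From mathcomp Require Import all_boot all_order all_algebra all_fingroup.
From mathcomp Require Import all_classical all_reals.
From mathcomp Require Import ereal sequences exp.
From mathcomp Require Import ring lra zify.
Import Order.TTheory GRing.Theory Num.Theory.
Local Open Scope ring_scope.

Set Implicit Arguments.
Unset Strict Implicit.
Unset Printing Implicit Defensive.

(** * Random choice of a deterministic strategy *)

Lemma take_zip (S T : Type) i (s : seq S) (t : seq T) :
  take i (zip s t) = zip (take i s) (take i t).
Proof. by elim: s t i => [|x s IH] [|y t] [|i] //=; rewrite ?IH //; case: take. Qed.

Section BehaviouralMixture.
Variables (R : realType) (m : nat) (Omega : finType).
Local Notation history := (seq (R * 'I_m.+1)).
Variable d : Omega -> history -> R -> 'I_m.+1.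

Definition follows (om : Omega) (h : history) : bool :=
  all (fun i => d om (take i h) (nth (0, ord0) h i).1
                == (nth (0, ord0) h i).2) (iota 0 (size h)).

Lemma follows_rcons om h y :
  follows om (rcons h y) = follows om h && (d om h y.1 == y.2).
Proof.
rewrite /follows size_rcons -(addn1 (size h)) iotaD all_cat /= add0n andbT.
rewrite nth_rcons ltnn eqxx -cats1 take_size_cat //; congr andb.
apply: eq_in_all => i; rewrite mem_iota /= add0n => ih.
by rewrite takel_cat 1?ltnW // nth_cat ih.
Qed.

Definition compatible (h : history) : nat := #|[pred om | follows om h]|.

(* Behaves like a uniformly random strategy [d om]: the next move is drawn from
   the posterior distribution of [om] given the history. *)
Definition mixture (h : history) (x : R) (j : 'I_m.+1) : R :=
  if compatible h == 0%N then (j == ord0)%:R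
  else (compatible (rcons h (x, j)))%:R / (compatible h)%:R.

Lemma mixture_ge0 h x j : 0 <= mixture h x j.
Proof. by rewrite /mixture; case: ifP => // _; rewrite divr_ge0. Qed.

Lemma mixture_sum1 h x : \sum_j mixture h x j = 1.
Proof.
rewrite /mixture; case: (boolP (compatible h == 0%N)) => [_|h0].
  by rewrite (bigD1 ord0) //= big1 ?addr0 // => j /negPf ->.
rewrite -mulr_suml -natr_sum.
suff -> : (\sum_j compatible (rcons h (x, j)) = compatible h)%N.
  by rewrite divff // pnatr_eq0.
rewrite [RHS]/compatible -sum1_card (partition_big (fun om => d om h x) predT) //=.
apply: eq_bigr => j _; rewrite /compatible -sum1_card.
by apply: eq_bigl => om; rewrite !inE follows_rcons.
Qed.

Lemma mixture_prod n (h : n.-tuple (R * 'I_m.+1)) : (0 < #|Omega|)%N ->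
  \prod_(i < n) mixture (take i h) (tnth h i).1 (tnth h i).2 =
  (compatible h)%:R / #|Omega|%:R.
Proof.
move=> O0.
have comp0 : compatible [::] = #|Omega| by rewrite /compatible; apply: eq_card.
suff H t : (t <= n)%N -> \prod_(0 <= i < t)
    mixture (take i h) (nth (0, ord0) h i).1 (nth (0, ord0) h i).2 =
    (compatible (take t h))%:R / #|Omega|%:R.
  have := H n (leqnn _); rewrite big_mkord take_oversize ?size_tuple // => <-.
  by apply: eq_bigr => i _; rewrite (tnth_nth (0, ord0)).
elim: t => [_|t IH tn]; first by rewrite big_geq // take0 comp0 divff // pnatr_eq0 -lt0n.
rewrite big_nat_recr //= IH 1?ltnW // (take_nth (0, ord0)) ?size_tuple //.
set g := take t h; set y := nth _ _ _.
rewrite /mixture; case: ifPn => g0; last first.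
  rewrite -surjective_pairing mulrAC mulrCA divff ?mulr1 // ?pnatr_eq0 //.
have -> : compatible (rcons g y) = 0%N.
  apply/eqP; rewrite -leqn0 -[X in (_ <= X)%N](eqP g0); apply: subset_leq_card.
  by apply/fintype.subsetP => om; rewrite !inE follows_rcons => /andP[].
by rewrite (eqP g0) !mul0r.
Qed.

Fixpoint play om (h : history) (s : seq R) : seq 'I_m.+1 :=
  if s is x :: s' then d om h x :: play om (rcons h (x, d om h x)) s' else [::].

Lemma size_play om h s : size (play om h s) = size s.
Proof. by elim: s h => //= x s IH h; rewrite IH. Qed.

Lemma follows_play om h s : follows om h -> follows om (h ++ zip s (play om h s)).
Proof.
elim: s h => [|x s IH] h hh /=; first by rewrite cats0.
by rewrite -cat_rcons; apply: IH; rewrite follows_rcons hh /=.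
Qed.

End BehaviouralMixture.

Lemma mixture_value_ge (R : realType) (A : online_alg R) (m n : nat) (Omega : finType)
    (d : Omega -> seq (R * 'I_m.+1) -> R -> 'I_m.+1) (s : n.-tuple R) (v : Omega -> R) :
  (0 < #|Omega|)%N -> (forall i, 0 <= tnth s i) ->
  A m.+1 n = mixture d ->
  (forall om (a : n.-tuple 'I_m.+1), follows d om (zip s a) -> v om <= minload s a) ->
  #|Omega|%:R^-1 * \sum_om v om <= alg_value A m.+1 s.
Proof.
move=> O0 s0 AE vP.
have minload_ge0 (a : n.-tuple 'I_m.+1) : 0 <= minload s a.
  rewrite /minload; elim/big_ind: _ => [|x y x0 y0|j _]; rewrite ?sumr_ge0 //.
  by rewrite le_min x0.
have probE (a : n.-tuple 'I_m.+1) :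
    assign_prob A s a = (compatible d (zip s a))%:R / #|Omega|%:R.
  rewrite -(mixture_prod _ [tuple of zip s a] O0) /assign_prob AE.
  apply: eq_bigr => i _; rewrite (tnth_nth (0, ord0)) /= nth_zip ?size_tuple //=.
  by rewrite take_zip -!tnth_nth.
rewrite /alg_value.
rewrite (eq_bigr (fun a : n.-tuple (ordinal m.+1) => #|Omega|%:R^-1 * ((compatible d (zip s a))%:R * minload s a))); last first.
  by move=> a _; rewrite probE mulrAC mulrC.
rewrite -mulr_sumr ler_wpM2l ?invr_ge0 //.
have -> : \sum_(a : n.-tuple 'I_m.+1) (compatible d (zip s a))%:R * minload s a =
    \sum_om \sum_(a : n.-tuple 'I_m.+1 | follows d om (zip s a)) minload s a.
  under [RHS]eq_bigr do rewrite big_mkcond.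
  rewrite [RHS]exchange_big /=; apply: eq_bigr => a _.
  by rewrite -big_mkcond sumr_const mulr_natl.
apply: ler_sum => om _.
have sz : size (play d om [::] s) == n by rewrite size_play size_tuple.
have F : follows d om (zip s (Tuple sz)) by exact: (@follows_play _ _ _ d om [::] s).
rewrite (bigD1 (Tuple sz)) //= ler_wpDr ?sumr_ge0 //; exact: vP.
Qed.

(** * Sampling without replacement *)

Section PermutationVariance.
Variables (R : realFieldType) (n : nat).
Implicit Types (w s : 'I_n -> R) (i j : 'I_n).

Lemma perm_mapping_pair i j i' j' : i != j -> i' != j' ->
  exists t : 'S_n, t i = i' /\ t j = j'.
Proof.
move=> ij ij'; exists (tperm i i' * tperm (tperm i i' j) j')%g.
have ne : tperm i i' j != i' by rewrite -[X in _ != X](tpermL i i') (inj_eq perm_inj) eq_sym.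
have ne' : j' != i' by rewrite eq_sym.
by rewrite !permM !tpermL (tpermD ne ne').
Qed.

Lemma perm_moment1 w i j :
  \sum_(t : 'S_n) w (t i) = \sum_(t : 'S_n) w (t j).
Proof.
rewrite (reindex_inj (mulgI (tperm i j))) /=.
by apply: eq_bigr => t _; rewrite permM tpermL.
Qed.

Lemma perm_moment2 w i j i' j' : i != j -> i' != j' ->
  \sum_(t : 'S_n) w (t i) * w (t j) = \sum_(t : 'S_n) w (t i') * w (t j').
Proof.
move=> ij ij'; have [u [ui uj]] := perm_mapping_pair ij ij'.
rewrite (reindex_inj (mulgI u)) /=.
by apply: eq_bigr => t _; rewrite !permM ui uj.
Qed.

(* Negative correlation: sampling without replacement has at most the variance
   of independent sampling, because the off-diagonal weights sum to
   [- \sum s i ^+ 2 <= 0]. *)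
Lemma perm_variance w s : (forall i, 0 <= w i) -> \sum_i s i = 0 ->
  (forall i, s i ^+ 2 <= 1) ->
  \sum_(t : 'S_n) (\sum_i s i * w (t i)) ^+ 2 <= n`!%:R * \sum_i w i ^+ 2.
Proof.
move=> w0 s0 s1.
pose E i j := \sum_(t : 'S_n) w (t i) * w (t j).
have [e2 e2_ge0 e2E] : exists2 e2, 0 <= e2 & forall i j, i != j -> E i j = e2.
  case: (pickP (fun ij : 'I_n * 'I_n => ij.1 != ij.2)) => [[i0 j0] /= ij0|no].
    exists (E i0 j0) => [|i j ij]; last exact: perm_moment2.
    by apply: sumr_ge0 => t _; rewrite mulr_ge0.
  by exists 0 => // i j ij; have := no (i, j); rewrite /= ij.
have Ediag i : n%:R * E i i = n`!%:R * \sum_i w i ^+ 2.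
  have Eii j : E j j = E i i by exact: (perm_moment1 (fun x => w x * w x)).
  transitivity (\sum_j E j j).
    by rewrite (eq_bigr (fun=> E i i)) // sumr_const card_ord mulr_natl.
  rewrite exchange_big /= (eq_bigr (fun=> \sum_i w i ^+ 2)).
    by rewrite sumr_const card_Sn mulr_natl.
  move=> t _; rewrite [RHS](reindex_inj (@perm_inj _ t)).
  by apply: eq_bigr => j _; rewrite expr2.
have -> : \sum_(t : 'S_n) (\sum_i s i * w (t i)) ^+ 2 =
    \sum_i \sum_j s i * s j * E i j.
  under eq_bigr => t _.
    rewrite expr2 mulr_suml; under eq_bigr => i _ do rewrite mulr_sumr.
    over.
  rewrite exchange_big; apply: eq_bigr => i _; rewrite exchange_big.
  apply: eq_bigr => j _; rewrite /E mulr_sumr; apply: eq_bigr => t _; ring.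
have -> : \sum_i \sum_j s i * s j * E i j = \sum_i s i ^+ 2 * (E i i - e2).
  apply: eq_bigr => i _; rewrite (bigD1 i) //=.
  rewrite (eq_bigr (fun j => s i * e2 * s j)); last first.
    by move=> j ji; rewrite e2E 1?eq_sym //; ring.
  rewrite -mulr_sumr.
  have -> : \sum_(j | j != i) s j = - s i.
    by move: s0; rewrite (bigD1 i) //= => /eqP; rewrite addrC addr_eq0 => /eqP.
  ring.
have [n0|n_gt0] := posnP n.
  rewrite [leLHS]big1 ?mulr_ge0 ?sumr_ge0 // => [i _|i _]; rewrite ?sqr_ge0 //.
  by have := ltn_ord i; rewrite {2}n0.
rewrite -(Ediag (Ordinal n_gt0)) mulr_natl.
have <- : \sum_(i < n) E (Ordinal n_gt0) (Ordinal n_gt0) = E (Ordinal n_gt0) (Ordinal n_gt0) *+ n.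
  by rewrite sumr_const card_ord.
apply: ler_sum => i _.
have -> : E (Ordinal n_gt0) (Ordinal n_gt0) = E i i.
  exact: (perm_moment1 (fun x => w x * w x)).
have Eii0 : 0 <= E i i by apply: sumr_ge0 => t _; rewrite mulr_ge0.
by have := s1 i; have := sqr_ge0 (s i); nra.
Qed.

End PermutationVariance.

Lemma chebyshev_count (R : realFieldType) (T : finType) (X : T -> R)
    (bad : pred T) (d v N : R) : 0 < d ->
  \sum_t X t ^+ 2 <= N * v -> v * 4 <= d ^+ 2 -> 0 <= N ->
  (forall t, bad t -> d ^+ 2 <= X t ^+ 2) -> #|bad|%:R <= N / 4.
Proof.
move=> d0 Xv vd N0 badX.
have : #|bad|%:R * d ^+ 2 <= N * (d ^+ 2 / 4).
  apply: le_trans (_ : \sum_t X t ^+ 2 <= _); last first.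
    by apply: le_trans Xv _; rewrite ler_wpM2l //; lra.
  rewrite mulr_natl -sumr_const (bigID bad predT) /=.
  by rewrite ler_wpDr ?sumr_ge0 // => [t _|]; rewrite ?sqr_ge0 // ler_sum.
have d2 : 0 < d ^+ 2 by rewrite exprn_gt0.
by rewrite mulrA mulrAC ler_pM2r.
Qed.

(** * Greedy assignment *)

Section Greedy.
Variables (R : realFieldType) (n m : nat).
Variables (s : 'I_n -> R) (a : 'I_n -> 'I_m) (P : pred 'I_m).
Hypothesis s_ge0 : forall i, 0 <= s i.

Definition prefix_load (t : nat) (j : 'I_m) : R :=
  \sum_(i < n | (i < t)%N && (a i == j)) s i.

Definition greedy_on : Prop :=
  forall i l, P (a i) -> P l -> prefix_load i (a i) <= prefix_load i l.

Let final_load j := \sum_(i | a i == j) s i.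

Hypothesis gr : greedy_on.

(* When the last job of machine [j] arrived, [j] was a least loaded machine
   of [P]; so all but one of its jobs fit below the load of [l]. *)
Lemma greedy_weight (f : 'I_n -> R) al b j l : 0 <= al -> 0 <= b ->
  (forall i, f i <= al * s i) -> (forall i, f i <= b) -> P j -> P l ->
  \sum_(i | a i == j) f i <= al * final_load l + b.
Proof.
move=> al0 b0 fs fb Pj Pl.
have fl0 : 0 <= final_load l by apply: sumr_ge0.
have [i0 ai0|none] := pickP (fun i => a i == j); last first.
  by rewrite big_pred0 // addr_ge0 ?mulr_ge0.
have [i /eqP ai imax] := @arg_maxnP _ i0 (fun i => a i == j) (fun i : 'I_n => i : nat) ai0.
rewrite (bigD1 i) ?ai //= addrC lerD //.
apply: (@le_trans _ _ (al * prefix_load i j)).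
  rewrite /prefix_load mulr_sumr.
  rewrite (eq_bigl (fun k : 'I_n => (k < i)%N && (a k == j))); last first.
    move=> k; rewrite andbC; case: (eqVneq (a k) j) => [akj|]; last by rewrite !andbF.
    have ki : (k <= i)%N by apply: imax; apply/eqP.
    by rewrite !andbT ltn_neqAle ki andbT.
  by apply: ler_sum.
rewrite ler_wpM2l // -ai; apply: (le_trans (gr _ Pl)); first by rewrite ai.
rewrite /final_load [leRHS](bigID (fun k : 'I_n => (k < i)%N)) /=.
rewrite (eq_bigl _ _ (fun k => andbC _ _)).
by rewrite ler_wpDr // sumr_ge0.
Qed.

Lemma greedy_large (c : R) l : 0 < c -> P l ->
  (#|P| <= #|[pred i | P (a i) && (c <= s i)%R]|)%N -> c <= final_load l.
Proof.
move=> c0 Pl; apply: contraTT; rewrite -ltNge -ltnNge => lc.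
pose N j := #|[pred i | (a i == j) && (c <= s i)%R]|.
have N1 j : P j -> (N j <= 1)%N.
  move=> Pj; rewrite -ltnS -(ltr_nat R).
  pose f i : R := (c <= s i)%R%:R.
  have fE : (N j)%:R = \sum_(i | a i == j) f i.
    rewrite /N -sum1_card natr_sum big_mkcondr /=; apply: eq_bigr => i _.
    by rewrite /f; case: ifP.
  rewrite fE; apply: le_lt_trans (_ : c^-1 * final_load l + 1 < _).
    apply: greedy_weight; rewrite ?invr_ge0 1?ltW // => i; rewrite /f.
      case: (leP c (s i)) => [cs|_] /=; last by rewrite mulr_ge0 ?invr_ge0 // ltW.
      by rewrite mulrC ler_pdivlMr // mul1r.
    by case: (leP c (s i)).
  by rewrite (_ : 2%:R = 1 + 1) // ltrD2r mulrC ltr_pdivrMr // mul1r.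
have Nl : N l = 0%N.
  apply/eqP; rewrite -leqn0 leqNgt; apply/negP => /card_gt0P[i /andP[/= ail ci]].
  have : c <= final_load l.
    by rewrite /final_load (bigD1 i) //= ler_wpDr // sumr_ge0.
  by rewrite leNgt lc.
have -> : #|[pred i | P (a i) && (c <= s i)%R]| = (\sum_(j | P j) N j)%N.
  rewrite -sum1_card (partition_big a P) /= => [|i /andP[]//].
  apply: eq_bigr => j Pj; rewrite /N -sum1_card; apply: eq_bigl => i.
  by rewrite !inE; case: eqVneq => [->|]; rewrite ?andbF // Pj andbT.
rewrite (bigD1 l) //= Nl add0n -sum1_card [ltnRHS](bigD1 l) //= add1n ltnS.
by apply: leq_sum => j /andP[/N1].
Qed.

Lemma greedy_volume (c : R) l : 0 <= c -> P l ->
  \sum_(i | P (a i)) Num.min (s i) c <= #|P|%:R * (final_load l + c).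
Proof.
move=> c0 Pl; rewrite (partition_big a P) //= mulr_natl -sumr_const.
apply: ler_sum => j Pj.
rewrite (eq_bigl (fun i => a i == j)) => [|i]; last first.
  by case: eqVneq => [->|]; rewrite ?andbF // Pj.
rewrite -[final_load l]mul1r; apply: greedy_weight => // i.
  by rewrite mul1r ge_min lexx.
by rewrite ge_min lexx orbT.
Qed.

End Greedy.

(** * An upper bound on the optimum *)

Section OptimumBound.
Variables (R : realType) (m n : nat) (p : n.-tuple R).
Hypothesis p_ge0 : forall i, 0 <= tnth p i.

Lemma minload_le (a : n.-tuple 'I_m) j : minload p a <= load p a j.
Proof. exact: bigmin_le_cond. Qed.

Lemma minload_ge (a : n.-tuple 'I_m.+1) v :
  (forall j, v <= load p a j) -> v <= minload p a.
Proof.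
move=> H; rewrite /minload; apply/bigmin_geP; split=> [|j _]; last exact: H.
apply: le_trans (H ord0) _.
by rewrite [leRHS](bigID (fun i => tnth a i == ord0)) /= ler_wpDr // sumr_ge0.
Qed.

Lemma OPT_ge0 : 0 <= OPT m p.
Proof. exact: bigmax_ge_id. Qed.

(* The machines of an optimal schedule that receive no job of size at least [c]
   number at least [m - l], and share the total volume of the other jobs. *)
Lemma OPT_small_volume (c : R) (l := #|[pred i | c <= tnth p i]|) :
  (l < m)%N -> (m - l)%:R * OPT m p <= \sum_(i | tnth p i < c) tnth p i.
Proof.
move=> lm; have ml0 : 0 < (m - l)%:R :> R by rewrite ltr0n subn_gt0.
rewrite mulrC -ler_pdivlMr //; apply/bigmax_leP; split=> [|a _].
  by rewrite divr_ge0 // sumr_ge0.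
rewrite ler_pdivlMr // mulrC.
pose Q := [pred j | [forall i, (tnth a i == j) ==> (tnth p i < c)]].
have mlQ : (m - l <= #|Q|)%N.
  rewrite leq_subLR -[leqLHS]card_ord -(cardC Q) addnC leq_add2r.
  apply: leq_trans (_ : _ <= #|[seq tnth a i | i in [pred i | (c <= tnth p i)%R]]|)%N _;
    last exact: leq_image_card.
  apply: subset_leq_card; apply/fintype.subsetP => j; rewrite 2!inE.
  case/forallPn => i; rewrite negb_imply -leNgt => /andP[/eqP <- ci].
  by apply: (@fintype.image_f _ _ (tnth a) [pred i | (c <= tnth p i)%R]).
apply: le_trans (_ : \sum_(j | Q j) load p a j <= _).
  apply: le_trans (_ : #|Q|%:R * minload p a <= _).
    rewrite ler_wpM2r ?ler_nat //; apply/bigmin_geP; split; rewrite ?sumr_ge0 //.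
    by move=> j _; rewrite sumr_ge0.
  by rewrite mulr_natl -sumr_const; apply: ler_sum => j _; exact: minload_le.
rewrite /load (exchange_big_dep (fun i => tnth p i < c)) /=; last first.
  by move=> j i /forallP/(_ i) /implyP H /H.
apply: ler_sum => i _; rewrite sumr_const -[leRHS]mulr1n ler_wpMn2l //.
rewrite -(card1 (tnth a i)); apply: subset_leq_card.
by apply/fintype.subsetP => j; rewrite !inE eq_sym => /andP[].
Qed.

End OptimumBound.

(** * The algorithm *)

Lemma big_take_tuple (T : Type) (V : nmodType) (n k : nat) (t : n.-tuple T)
    (Q : pred T) (F : T -> V) :
  \sum_(y <- take k t | Q y) F y =
  \sum_(i < n | (i < k)%N && Q (tnth t i)) F (tnth t i).
Proof.
case: n t => [|n] t; first by rewrite tuple0 /= big_nil big_ord0.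
pose x0 := tnth t ord0.
rewrite (big_nth x0) size_take_min size_tuple big_mkcond (big_nat_widen _ _ _ _ _ (geq_minr k _)) /=.
rewrite big_mkord big_mkcond [RHS]big_mkcond /=; apply: eq_bigr => i _.
rewrite leq_min ltn_ord andbT; case: ltnP => //= ik.
by rewrite nth_take // (tnth_nth x0).
Qed.

Section Algorithm.
Variable R : realType.

Definition machine_load (m : nat) (h : seq (R * 'I_m)) (j : 'I_m) : R :=
  \sum_(y <- h | y.2 == j) y.1.

Definition small_machines (m j : nat) : nat :=
  if j is j'.+1 then minn (2 ^ j') m else 0%N.

Definition log_size (m : nat) : nat := (trunc_log 2 m).+1.

Definition half_window (m : nat) : nat := (Num.truncn (4 * Num.sqrt m%:R : R)).+1.

(* The window of candidate ranks is centred at the expected number of sampled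
   jobs among the [m] largest ones. *)
Definition sample_rank (m n e : nat) : nat := (n./2 * m %/ n + e - half_window m)%N.

Definition tail_volume (r : nat) (l : seq R) : R :=
  \sum_(x <- take (size l - r) (sort <=%R l)) x.

(* Rounding [ln] to an integer makes the cutoff range over a grid that does not
   depend on the sample. *)
Definition cutoff (T : R) (i : nat) : R := expR ((Num.floor (ln T))%:~R - i%:R).

Definition seed (m : nat) : finType :=
  ('I_(half_window m).*2.+1 * 'I_(log_size m + 10) * 'I_(log_size m + 3))%type.

Definition seed_cutoff (m n : nat) (om : seed m) (l : seq R) : R :=
  cutoff (tail_volume (sample_rank m n om.1.1) l) om.1.2.

(* [k = 0] turns the strategy into plain greedy. *)
Definition is_large (m n : nat) (om : seed m.+1) (h : seq (R * 'I_m.+1)) (x : R) : bool :=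
  let k := small_machines m.+1 om.2 in
  (k < m.+1)%N && [|| k == 0%N, (size h < n./2)%N |
    seed_cutoff n om (take n./2 (map fst h)) <= x].

Definition dest (m n : nat) (om : seed m.+1) (h : seq (R * 'I_m.+1)) (x : R) : 'I_m.+1 :=
  let b := is_large n om h x in
  [arg min_(j < (if b then ord_max else ord0)
      | (small_machines m.+1 om.2 <= j)%N == b) machine_load h j]%O.

Definition covering_alg : online_alg R := fun m =>
  if m is m'.+1 then fun n => mixture (@dest m' n) else fun _ _ _ _ => 0.

Lemma covering_alg_valid : valid_alg covering_alg.
Proof.
move=> [//|m] n h x _; split=> [j|]; [exact: mixture_ge0 | exact: mixture_sum1].
Qed.

Section Run.
Variables (m n : nat) (om : seed m.+1) (s : n.-tuple R) (a : n.-tuple 'I_m.+1).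
Hypothesis s_ge0 : forall i, 0 <= tnth s i.
Hypothesis fol : follows (@dest m n) om (zip s a).
Let k := small_machines m.+1 om.2.
Let c := seed_cutoff n om (take n./2 s).
Let large (i : 'I_n) : bool :=
  (k < m.+1)%N && [|| k == 0%N, (i < n./2)%N | c <= tnth s i].

Lemma run_dest (i : 'I_n) :
  (k <= tnth a i)%N = large i /\
  forall l : 'I_m.+1, (k <= l)%N = large i ->
    prefix_load (tnth s) (tnth a) i (tnth a i) <= prefix_load (tnth s) (tnth a) i l.
Proof.
have szt : size (take i (zip s a)) = i.
  by rewrite size_takel // size_zip !size_tuple minnn ltnW.
have loadE j : machine_load (take i (zip s a)) j = prefix_load (tnth s) (tnth a) i j.
  rewrite /machine_load (@big_take_tuple _ _ _ _ [tuple of zip s a]).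
  have E l : tnth [tuple of zip s a] l = (tnth s l, tnth a l).
    by rewrite (tnth_nth (0, ord0)) /= nth_zip ?size_tuple // -!tnth_nth.
  by apply: eq_big => l; rewrite E.
have largeE : is_large n om (take i (zip s a)) (tnth s i) = large i.
  rewrite /is_large /large szt -/k; case: (ltnP i n./2) => // ni.
  rewrite /c take_zip.
  have -> : [seq y.1 | y <- zip (take i s) (take i a)] = take i s.
    by rewrite -/(unzip1 _) unzip1_zip // !size_take !size_tuple.
  by rewrite take_takel.
have := allP fol i; rewrite mem_iota /= add0n size_zip !size_tuple minnn ltn_ord.
move=> /(_ isT); rewrite nth_zip ?size_tuple //= -!tnth_nth /dest largeE -/k => /eqP.
case: arg_minP => /= [|j jP jmin <-].
  case E: (large i); first by case/andP: E => km _; rewrite -ltnS km.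
  rewrite leqn0 eqbF_neg; apply/eqP => k0.
  by move: E; rewrite /large k0.
split; first exact: (eqP jP).
by move=> l lP; rewrite -!loadE; apply: jmin; apply/eqP.
Qed.

Lemma run_greedy_large : greedy_on (tnth s) (tnth a) (fun j => k <= j)%N.
Proof. by move=> i l ai Pl; have [E] := run_dest i; apply; rewrite -E Pl ai. Qed.

Lemma run_greedy_small : greedy_on (tnth s) (tnth a) (fun j => j < k)%N.
Proof.
move=> i l; rewrite !ltnNge => /negbTE ai /negbTE Pl; have [E] := run_dest i.
by apply; rewrite -E Pl ai.
Qed.

Lemma run_all_large b : k = 0%N -> 0 < b ->
  (m.+1 <= #|[pred i | (b <= tnth s i)%R]|)%N -> b <= minload s a.
Proof.
move=> k0 b0 H; apply: minload_ge => // j.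
apply: (greedy_large s_ge0 run_greedy_large) => //=; first by rewrite k0.
rewrite k0 (eq_card (B := 'I_m.+1)) // card_ord.
by rewrite (eq_card (B := [pred i | (b <= tnth s i)%R])).
Qed.

Lemma run_all_volume b : k = 0%N -> 0 <= b ->
  m.+1%:R * (b * 2) <= \sum_i Num.min (tnth s i) b -> b <= minload s a.
Proof.
move=> k0 b0 H; apply: minload_ge => // j.
have := greedy_volume s_ge0 run_greedy_large (l := j) b0; rewrite k0 => /(_ isT).
rewrite (eq_card (B := 'I_m.+1)) // card_ord => H'.
have := le_trans H H'; rewrite ler_pM2l ?ltr0n // /load; lra.
Qed.

Lemma run_split : (0 < k <= m.+1)%N -> 0 < c ->
  (m.+1 - k <= #|[pred i | (c <= tnth s i)%R]|)%N ->
  k%:R * (c * 2) <= \sum_(i < n | (n./2 <= i)%N && (tnth s i < c)) tnth s i ->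
  c <= minload s a.
Proof.
move=> /andP[k0 km] c0 H1 H2; apply: minload_ge => // j.
have cardB : #|[pred j : 'I_m.+1 | (j < k)%N]| = k.
  rewrite -sum1_card (big_ord_narrow_cond (P := predT)) //= sum1_card card_ord //.
have cardA : #|[pred j : 'I_m.+1 | (k <= j)%N]| = (m.+1 - k)%N.
  have := cardC [pred j : 'I_m.+1 | (j < k)%N]; rewrite cardB card_ord.
  rewrite (eq_card (B := [pred j : 'I_m.+1 | (k <= j)%N])).
    by move=> C; apply/eqP; rewrite -(eqn_add2l k) subnKC //; apply/eqP.
  by move=> l; rewrite !inE -leqNgt.
have [kj|jk] := leqP k j.
  apply: (@greedy_large _ _ _ _ _ _ s_ge0 run_greedy_large c j) => //.
  rewrite (eq_card (B := [pred j : 'I_m.+1 | (k <= j)%N])) // cardA.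
  apply: leq_trans H1 _; apply: subset_leq_card; apply/fintype.subsetP => i.
  rewrite !inE => ci; rewrite ci andbT (run_dest i).1 /large ci !orbT andbT.
  exact: leq_ltn_trans kj _.
have := greedy_volume s_ge0 run_greedy_small (ltW c0) jk.
rewrite (eq_card (B := [pred j : 'I_m.+1 | (j < k)%N])) // cardB => H'.
have /(le_trans H2) : \sum_(i < n | (n./2 <= i)%N && (tnth s i < c)) tnth s i <=
    \sum_(i | (tnth a i < k)%N) Num.min (tnth s i) c.
  rewrite [leLHS]big_mkcond [leRHS]big_mkcond; apply: ler_sum => i _.
  case: ifP => [/andP[ni ic]|_]; last by case: ifP => // _; rewrite le_min s_ge0 ltW.
  have -> : (tnth a i < k)%N.
    by rewrite ltnNge (run_dest i).1 /large eqn0Ngt k0 (leq_gtF ni) leNgt ic andbF.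
  by rewrite le_min lexx ltW.
move=> /le_trans/(_ H'); rewrite ler_pM2l ?ltr0n // /load; lra.
Qed.

End Run.
End Algorithm.

Lemma tail_volume_bounds (R : realType) (l : seq R) (b : R) (r : nat) :
  0 < b -> (forall x, x \in l -> 0 <= x) ->
  (count (fun x => (b <= x)%R) l <= r)%N ->
  \sum_(x <- l | x < b) x - (r - count (fun x => (b <= x)%R) l)%N%:R * b
    <= tail_volume r l <= \sum_(x <- l | x < b) x.
Proof.
move=> b0 l0; set a := count _ _ => ar.
set y := sort <=%R l; set z := [seq x <- y | x < b].
have yl : perm_eq y l by rewrite perm_sort.
have zE : z = take (size l - a) y.
  have -> : (size l - a)%N = count (< b) y.
    rewrite (seq.permP yl) -(count_predC (fun x => (b <= x)%R)) addKn.
    by apply: eq_count => x /=; rewrite -ltNge.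
  by apply: sorted_filter_lt; exact: sort_le_sorted.
have S1E : \sum_(x <- l | x < b) x = \sum_(x <- z) x.
  by rewrite big_filter; apply/esym/perm_big.
have z0 x : x \in z -> 0 <= x < b.
  by rewrite mem_filter (perm_mem yl) => /andP[-> /l0 ->].
have -> : tail_volume r l = \sum_(x <- take (size z - (r - a)) z) x.
  rewrite zE size_takel; last by rewrite size_sort leq_subr.
  rewrite take_takel ?leq_subr // -subnDA subnKC //.
rewrite S1E -[in X in X - _ <= _](cat_take_drop (size z - (r - a)) z).
rewrite -[in X in _ <= _ <= X](cat_take_drop (size z - (r - a)) z).
rewrite !big_cat /=; apply/andP; split; last first.
  rewrite lerDl big_seq sumr_ge0 // => x /mem_drop /z0 /andP[]//.
rewrite lerBlDr lerD2l; apply: le_trans (_ : \sum_(x <- drop (size z - (r - a)) z) b <= _).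
  rewrite big_seq [leRHS]big_seq; apply: ler_sum => x /mem_drop /z0 /andP[_ /ltW]//.
rewrite big_const_seq count_predT iter_addr_0 -[leLHS]mulr_natl ler_wpM2r ?ler_nat ?ltW //.
by rewrite size_drop; lia.
Qed.

Lemma sample_deviation (R : realFieldType) (n : nat) (w : 'I_n -> R)
    (th := (n./2)%:R / n%:R : R) : (0 < n)%N -> (forall i, 0 <= w i) ->
  \sum_(t : 'S_n) (\sum_(i < n | (i < n./2)%N) w (t i) - th * \sum_i w i) ^+ 2
    <= n`!%:R * \sum_i w i ^+ 2.
Proof.
move=> n0 w0; have nR : 0 < n%:R :> R by rewrite ltr0n.
have th01 : 0 <= th <= 1.
  rewrite divr_ge0 //= ler_pdivrMr // mul1r ler_nat; lia.
pose s (i : 'I_n) : R := (i < n./2)%N%:R - th.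
apply: le_trans (perm_variance (s := s) w0 _ _).
- apply: ler_sum => t _; rewrite le_eqVlt; apply/orP; left; apply/eqP; congr (_ ^+ 2).
  rewrite [X in _ * X](reindex_inj (@perm_inj _ t)) mulr_sumr [X in X - _]big_mkcond -sumrB.
  by apply: eq_bigr => i _; rewrite /s mulrBl; case: ifP => _; rewrite ?mul1r ?mul0r.
- rewrite sumrB sumr_const card_ord -mulr_natl /th mulrCA divff ?gt_eqF // mulr1.
  rewrite -natr_sum; apply/eqP; rewrite subr_eq0 eqr_nat; apply/eqP.
  rewrite -big_mkcond (big_ord_narrow_cond (P := predT)) //=; first by lia.
  by move=> le; rewrite sum1_card card_ord.
- move=> i; rewrite /s; case: (i < _)%N => /=; nra.
Qed.

(** * Guessing the optimum *)

Lemma log_size_bound (R : realType) (m : nat) : (0 < m)%N ->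
  ln (128 * m%:R : R) <= (log_size m)%:R + 7.
Proof.
move=> m0; have /andP[_ mlt] := trunc_log_bounds (isT : (1 < 2)%N) m0.
have mR : 0 < m%:R :> R by rewrite ltr0n.
apply: (@le_trans _ _ (ln (2 ^+ (log_size m + 7)))).
  rewrite ler_ln ?posrE ?mulr_gt0 ?exprn_gt0 // exprD mulrC.
  rewrite (_ : 2 ^+ 7 = 128) ?ler_wpM2r // -?natrX; last by congr (_%:R).
  by rewrite ler_nat ltnW.
have ln2 : ln 2 <= 1 :> R by apply: (@le_ln1Dx R 1); rewrite (lt_trans _ ltr01) // ltrN10.
by rewrite lnXn // -[ln 2 *+ _]mulr_natl natrD ler_piMr ?addr_ge0.
Qed.

Lemma cutoff_hit (R : realType) (m : nat) (T V : R) : (0 < m)%N -> 0 < V ->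
  V / 64 <= T <= m%:R * (V * 2) ->
  exists i : 'I_(log_size m + 10),
    cutoff T i = expR (Num.floor (ln (V / 64)))%:~R.
Proof.
move=> m0 V0 /andP[T1 T2].
have V64 : 0 < V / 64 by rewrite divr_gt0.
have mR : 0 < m%:R :> R by rewrite ltr0n.
have T0 : 0 < T by exact: lt_le_trans T1.
set z := Num.floor (ln (V / 64)); set y := Num.floor (ln T).
have zy : z <= y by rewrite le_floor // ler_ln.
have lnT : ln T <= ln (V / 64) + ln (128 * m%:R).
  rewrite -lnM ?posrE ?mulr_gt0 // ler_ln ?posrE ?mulr_gt0 //.
  apply: le_trans T2 _; lra.
have [d yE] : exists d : nat, y = z + d%:Z by exists `|y - z|%N; lia.
have dlt : (d < log_size m + 10)%N.
  have yT : y%:~R <= ln T by exact: floor_le.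
  have zV : ln (V / 64) < z%:~R + 1 by rewrite -[1]/(1%:~R) -intrD floorD1_gt.
  have := log_size_bound R m0.
  rewrite -(ltr_nat R) natrD; move: yT; rewrite yE intrD => yT lb.
  have -> : 10%:R = 7 + 3 :> R by rewrite -natrD.
  rewrite -[d%:R]/(d%:Z%:~R : R); lra.
exists (Ordinal dlt); rewrite /cutoff -/y yE intrD /= -[d%:~R]/(d%:R : R).
by rewrite addrK.
Qed.

Section GoodOrder.
Variables (R : realType) (m n : nat) (s : n.-tuple R) (V q : R) (K : nat).
Let th : R := (n./2)%:R / n%:R.
Let b := V / (144 * q).
Let sample_volume := \sum_(i < n | (i < n./2)%N && (tnth s i < b)) tnth s i.
Let sample_count := #|[pred i : 'I_n | (i < n./2)%N && (b <= tnth s i)%R]|.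

Hypotheses (s_ge0 : forall i, 0 <= tnth s i) (m_gt0 : (0 < m)%N) (n_gt0 : (0 < n)%N).
Hypotheses (V_gt0 : 0 < V) (q_ge1 : 1 <= q) (qm : q ^+ 4 = m%:R).
Hypotheses (K_gt0 : (0 < K)%N).
Hypothesis volume_ge : K%:R * V / 6 <= sample_volume.
Hypothesis volume_le : sample_volume <= m%:R * (V * 2).
Hypothesis count_le : sample_count%:R <= th * (m%:R - K%:R) + 2 * q ^+ 2.
Hypothesis count_ge : th * (m%:R - K%:R) - 2 * q ^+ 2 <= sample_count%:R.

Lemma sample_tail (r : nat) : (sample_count <= r)%N ->
  (r - sample_count)%N%:R <= 12 * q * K%:R ->
  V / 64 <= tail_volume r (take n./2 s) <= m%:R * (V * 2).
Proof.
move=> ar rle.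
have q0 : 0 < q by exact: lt_le_trans q_ge1.
have b0 : 0 < b by rewrite divr_gt0 ?mulr_gt0.
have countE : count (fun x => (b <= x)%R) (take n./2 s) = sample_count.
  by rewrite -sum1_count big_take_tuple /sample_count -sum1_card.
have l0 x : x \in take n./2 s -> 0 <= x.
  by move=> /mem_take /tnthP[i ->].
have := tail_volume_bounds b0 l0; rewrite countE => /(_ r ar).
rewrite big_take_tuple -/sample_volume => /andP[H1 H2]; apply/andP; split.
  apply: le_trans H1.
  have : (r - sample_count)%N%:R * b <= K%:R * V / 12.
    apply: le_trans (_ : 12 * q * K%:R * b <= _); first by rewrite ler_wpM2r // ltW.
    by rewrite /b le_eqVlt; apply/orP; left; apply/eqP; field; rewrite gt_eqF.
  have K1 : 1 <= K%:R :> R by rewrite ler1n.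
  have : V <= K%:R * V by rewrite ler_peMl // ltW.
  move: V_gt0 volume_ge; set S := sample_volume; lra.
exact: le_trans H2 volume_le.
Qed.

Lemma good_order_seeds (j : 'I_(log_size m + 3)) :
  (Num.truncn q <= #|[pred om : seed R m |
    (seed_cutoff n om (take n./2 s) == expR (Num.floor (ln (V / 64)))%:~R)
    && (om.2 == j)]|)%N.
Proof.
set G := [pred om : seed R m | _]; set g := Num.truncn q.
have [q1 V0] := (q_ge1, V_gt0).
pose W := half_window R m; pose z := (n./2 * m %/ n)%N.
pose a := sample_count; pose r0 := maxn a (z - W).
have q0 : 0 < q by exact: lt_le_trans q_ge1.
have sqrtm : Num.sqrt m%:R = q ^+ 2 :> R.
  by rewrite -qm (exprM q 2 2) sqrtr_sqr ger0_norm // sqr_ge0.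
have Wgt : 4 * q ^+ 2 < W%:R by rewrite -sqrtm; exact: truncnS_gt.
have gq : g%:R <= q by rewrite truncn_le ltW.
have nR : 0 < n%:R :> R by rewrite ltr0n.
have K1 : 1 <= K%:R :> R by rewrite ler1n.
have th01 : 0 <= th <= 1.
  by rewrite divr_ge0 //= ler_pdivrMr // mul1r ler_nat leq_half_double -addnn -addnS leq_addr.
have thm : th * m%:R = (n./2 * m)%N%:R / n%:R by rewrite natrM mulrAC.
have zle : z%:R <= th * m%:R.
  by rewrite thm ler_pdivlMr // -natrM ler_nat leq_divM.
have zgt : th * m%:R < z%:R + 1.
  by rewrite thm ltr_pdivrMr // natr1 -natrM ltr_nat ltn_ceil.
have qq : q <= q ^+ 2 by rewrite expr2 ler_peMl // ltW.
have Q1 : 1 <= q ^+ 2 by exact: le_trans qq.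
move: (q ^+ 2) count_le count_ge qq Q1 sqrtm Wgt => Q count_leQ count_geQ qq Q1 sqrtm Wgt.
have thK : 0 <= th * K%:R <= K%:R.
  by case/andP: th01 => *; rewrite mulr_ge0 // ler_piMl.
have qK : K%:R <= q * K%:R by rewrite ler_peMl.
have qK' : q <= q * K%:R by rewrite ler_peMr // ltW.
have az : a%:R <= z%:R + 1 + 2 * Q.
  by case/andP: thK => *; apply: le_trans count_leQ _; rewrite mulrBr; lra.
have r0W : (r0 + g <= z + W)%N.
  rewrite -(ler_nat R) !natrD /r0; case: (leqP (z - W) a) => zWa.
    lra.
  rewrite natrB; first lra.
  by rewrite ltnW // -subn_gt0; apply: leq_ltn_trans zWa.
have r0t t : (t < g)%N -> ((r0 + t) - a)%N%:R <= 12 * q * K%:R.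
  move=> tg; have tq : t%:R <= q by apply: le_trans gq; rewrite ler_nat ltnW.
  rewrite /r0; case: (leqP (z - W) a) => zWa.
    by rewrite addKn; lra.
  have zW : (W <= z)%N by rewrite ltnW // -subn_gt0; apply: leq_ltn_trans zWa.
  rewrite natrB; last by rewrite (leq_trans (ltnW zWa)) ?leq_addr.
  rewrite natrD natrB //.
  by case/andP: thK => *; move: count_geQ; rewrite -/a mulrBr; lra.
have r0z : (z <= r0 + W)%N by rewrite addnC -leq_subLR leq_maxr.
pose e (t : 'I_g) : 'I_W.*2.+1 := inord (r0 + t + W - z).
have eE (t : 'I_g) : e t = (r0 + t + W - z)%N :> nat.
  rewrite /e inordK //; move: (ltn_ord t) r0W; clear; lia.
have e_inj : injective e.
  move=> t u /(congr1 (@nat_of_ord _)); rewrite !eE => H; apply: val_inj => /=; move: H r0z; clear; lia.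
rewrite -[g]card_ord -(card_codom e_inj).
apply: leq_trans (_ : _ <= #|[seq om.1.1 | om in G]|)%N _; last exact: leq_image_card.
apply: subset_leq_card; apply/fintype.subsetP => _ /codomP[t ->].
have rk : sample_rank R m n (e t) = (r0 + t)%N.
  rewrite /sample_rank eE -/W -/z; move: r0z; clear; lia.
have ar0 : (a <= r0 + t)%N by apply: leq_trans (leq_addr _ _); exact: leq_maxl.
have [i iE] := cutoff_hit m_gt0 V_gt0 (sample_tail ar0 (r0t _ (ltn_ord t))).
have omG : (e t, i, j) \in G by rewrite !inE /seed_cutoff /= rk iE !eqxx.
by apply/fintype.imageP; exists (e t, i, j).
Qed.

End GoodOrder.

(** * Random arrival order *)

Lemma arrival_sum (R : realType) (V : nmodType) (n : nat) (p : n.-tuple R)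
    (t : 'S_n) (Q : pred R) (F : R -> V) :
  \sum_(i | Q (tnth (arrival p t) i)) F (tnth (arrival p t) i) =
  \sum_(i | Q (tnth p i)) F (tnth p i).
Proof.
rewrite [RHS](reindex_inj (@perm_inj _ t)) /=.
by apply: eq_big => [i|i _]; rewrite tnth_mktuple.
Qed.

Lemma arrival_card (R : realType) (n : nat) (p : n.-tuple R) (t : 'S_n) (Q : pred R) :
  #|[pred i | Q (tnth (arrival p t) i)]| = #|[pred i | Q (tnth p i)]|.
Proof.
by rewrite -!sum1_card; exact: (@arrival_sum _ nat _ _ _ Q (fun=> 1%N)).
Qed.

Section RandomOrder.
Variables (R : realType) (m n : nat) (p : n.-tuple R).
Let M := m.+1.
Let N : nat := #|seed R M|.

Hypothesis p_ge0 : forall i, 0 <= tnth p i.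

Lemma rom_value_ge (good : pred 'S_n) (G : 'S_n -> pred (seed R M)) (g : nat) (v : R) :
  0 <= v -> (forall t, good t -> (g <= #|G t|)%N) ->
  (forall t om (a : n.-tuple 'I_M), good t -> G t om ->
     follows (@dest R m n) om (zip (arrival p t) a) -> v <= minload (arrival p t) a) ->
  #|good|%:R * (g%:R * v) / (n`!%:R * N%:R) <= rom_value (@covering_alg R) M p.
Proof.
move=> v0 gG vP; have N0 : (0 < N)%N by apply/card_gt0P; exists (ord0, inord 0, inord 0).
have NR : 0 < N%:R :> R by rewrite ltr0n.
have nf : 0 < n`!%:R :> R by rewrite ltr0n fact_gt0.
pose val t om : R := if good t && G t om then v else 0.
have val_ge0 t om : 0 <= val t om by rewrite /val; case: ifP.
apply: le_trans (_ : n`!%:R^-1 * \sum_t (N%:R^-1 * \sum_om val t om) <= _).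
  rewrite -mulr_sumr invfM mulrC -mulrA ler_wpM2l ?invr_ge0 // ler_wpM2l ?invr_ge0 //.
  rewrite mulr_natl -sumr_const [leRHS](bigID good) /= ler_wpDr ?sumr_ge0 // => [t _|].
    exact: sumr_ge0.
  apply: ler_sum => t gt; rewrite -big_mkcond.
  rewrite (eq_bigl (G t)) => [|om]; last by rewrite [good t]gt.
  by rewrite sumr_const -[leRHS]mulr_natl ler_wpM2r // ler_nat gG.
rewrite /rom_value ler_wpM2l ?invr_ge0 ?ler0n //; apply: ler_sum => t _.
apply: mixture_value_ge => // [i|om a fol]; first by rewrite tnth_mktuple.
rewrite /val; case: ifP => [/andP[gt Gt]|_]; first exact: vP fol.
apply: minload_ge => [i|j]; first by rewrite tnth_mktuple.
by apply: sumr_ge0 => i _; rewrite tnth_mktuple.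
Qed.

Lemma seed_card : N = ((half_window R M).*2.+1 * (log_size M + 10) * (log_size M + 3))%N.
Proof. by rewrite /N /seed !card_prod !card_ord. Qed.

Lemma seed_mode_card (j : 'I_(log_size M + 3)) :
  #|[pred om : seed R M | om.2 == j]| =
  ((half_window R M).*2.+1 * (log_size M + 10))%N.
Proof.
rewrite (eq_card (B := [predX {: 'I_(half_window R M).*2.+1 * 'I_(log_size M + 10)} & pred1 j])).
  by rewrite cardX card1 muln1 card_prod !card_ord.
by case=> x y; rewrite !inE.
Qed.

Lemma pure_greedy_rom (v : R) : 0 <= v ->
  (forall t (om : seed R M) (a : n.-tuple 'I_M), small_machines M om.2 = 0%N ->
     follows (@dest R m n) om (zip (arrival p t) a) -> v <= minload (arrival p t) a) ->
  v / (log_size M + 3)%:R <= rom_value (@covering_alg R) M p.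
Proof.
move=> v0 vP.
have lt0 : (0 < log_size M + 3)%N by rewrite addnC.
pose j0 : 'I_(log_size M + 3) := Ordinal lt0.
have := @rom_value_ge predT (fun=> [pred om | om.2 == j0]) _ v v0 (fun _ _ => leqnn _).
rewrite seed_mode_card (eq_card (B := 'S_n)) // card_Sn seed_card => H.
apply: le_trans (H _); last first.
  by move=> t om a _ /eqP om0 fol; apply: vP fol; rewrite om0.
rewrite -mulf_div divff ?mul1r; last by rewrite pnatr_eq0 -lt0n fact_gt0.
rewrite [X in _ <= _ / X]natrM -mulf_div divff ?mul1r //.
Qed.

End RandomOrder.

Lemma half_ratio_bounds (R : realFieldType) (n : nat) : (2 <= n)%N ->
  1 / 3 <= (n./2)%:R / n%:R :> R /\ (n./2)%:R / n%:R <= 1 / 2 :> R.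
Proof.
move=> n2; have nR : 0 < n%:R :> R by rewrite ltr0n ltnW.
have h1 : (n <= 3 * n./2)%N by lia.
have h2 : (2 * n./2 <= n)%N by lia.
rewrite ler_pdivlMr // ler_pdivrMr //.
move: h1 h2; rewrite -!(ler_nat R) !natrM => h1 h2; split; lra.
Qed.

Section Deviation.
Variables (R : realType) (n : nat) (w : 'I_n -> R).
Let th : R := (n./2)%:R / n%:R.
Definition deviation (t : 'S_n) : R :=
  \sum_(i < n | (i < n./2)%N) w (t i) - th * \sum_i w i.
Definition bad_order (d : R) : pred 'S_n := [pred t | d ^+ 2 <= deviation t ^+ 2].

Lemma bad_order_card d : (0 < n)%N -> (forall i, 0 <= w i) -> 0 < d ->
  (\sum_i w i ^+ 2) * 4 <= d ^+ 2 -> #|bad_order d|%:R <= n`!%:R / 4 :> R.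
Proof.
move=> n0 w0 d0 wd.
by apply: (chebyshev_count d0 (sample_deviation n0 w0) wd) => //; rewrite ler0n.
Qed.

Lemma good_order_lt d t : 0 < d -> ~~ bad_order d t -> - d < deviation t < d.
Proof.
move=> d0; rewrite /= -ltNge => H.
by rewrite -ltr_norml -(@ltr_pXn2r _ 2) ?nnegrE ?normr_ge0 ?ltW // real_normK ?num_real.
Qed.
End Deviation.

Section Main.
Variables (R : realType) (m n : nat) (p : n.-tuple R) (q : R).
Let M := m.+1.
Let V := OPT M p.
Let C : R := expR (Num.floor (ln (V / 64)))%:~R.
Let th : R := (n./2)%:R / n%:R.

Hypotheses (p_ge0 : forall i, 0 <= tnth p i) (M_ge2 : (2 <= M)%N) (V_gt0 : 0 < V).
Hypotheses (q_ge1 : 1 <= q) (qm : q ^+ 4 = M%:R).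

Lemma jobs_ge_machines : (M <= n)%N.
Proof.
rewrite leqNgt; apply/negP => nM.
have := @OPT_small_volume R M n p p_ge0 0.
rewrite (eq_card (B := 'I_n)) => [|i]; last by rewrite !inE p_ge0.
rewrite card_ord => /(_ nM); rewrite big_pred0 => [|i]; last by rewrite ltNge p_ge0.
by rewrite leNgt mulr_gt0 // ltr0n subn_gt0.
Qed.

Lemma C_bounds : [/\ 0 < C, C <= V / 64 & V / 64 * expR (-1) <= C].
Proof.
have V64 : 0 < V / 64 by rewrite divr_gt0.
split; first exact: expR_gt0.
  rewrite -[leRHS]lnK ?posrE // ler_expR; exact: floor_le.
rewrite -{1}[V / 64]lnK ?posrE // -expRD ler_expR lerBlDr -[1]/(1%:~R) -intrD ltW //.
exact: floorD1_gt.
Qed.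

Lemma good_rom (b := V / (144 * q)) :
  (#|[pred i | (b <= tnth p i)%R]| < M)%N ->
  (#|[pred i | (C <= tnth p i)%R]| < M)%N ->
  \sum_i Num.min (tnth p i) V <= M%:R * (V * 2) ->
  (Num.truncn q)%:R * C / (4 * #|seed R M|%:R) <= rom_value (@covering_alg R) M p.
Proof.
move=> lb lC vol; have [C0 CV _] := C_bounds.
have nM := jobs_ge_machines; have n2 : (2 <= n)%N by exact: leq_trans nM.
have n0 : (0 < n)%N by exact: ltnW.
have [th3 th2] := half_ratio_bounds R n2; rewrite -/th in th3 th2.
have q0 : 0 < q by exact: lt_le_trans q_ge1.
have q20 : 0 < q ^+ 2 by rewrite exprn_gt0.
have b0 : 0 < b by rewrite divr_gt0 ?mulr_gt0.
have b144 : b * 144 <= V.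
  rewrite /b invfM mulrA mulrAC divfK // ler_pdivrMr // ler_peMr // ltW //.
have bV : b <= V by apply: le_trans b144; rewrite ler_peMr ?ler1n // ltW.
pose w1 i := if tnth p i < b then tnth p i else 0.
pose w2 i : R := (b <= tnth p i)%R%:R.
pose w3 i := if tnth p i < C then tnth p i else 0.
have w10 i : 0 <= w1 i by rewrite /w1; case: ifP.
have w20 i : 0 <= w2 i by rewrite ler0n.
have w30 i : 0 <= w3 i by rewrite /w3; case: ifP.
set S1 := \sum_i w1 i; set S2 := \sum_i w2 i; set S3 := \sum_i w3 i.
pose K := (M - #|[pred i | (b <= tnth p i)%R]|)%N.
pose k0 := (M - #|[pred i | (C <= tnth p i)%R]|)%N.
have K0 : (0 < K)%N by rewrite subn_gt0.
have k00 : (0 < k0)%N by rewrite subn_gt0.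
have KS : K%:R * V <= S1.
  by rewrite /S1 /w1 -big_mkcond; exact: OPT_small_volume.
have kS : k0%:R * V <= S3.
  by rewrite /S3 /w3 -big_mkcond; exact: OPT_small_volume.
have S2E : S2 = #|[pred i | (b <= tnth p i)%R]|%:R.
  rewrite -sum1_card natr_sum big_mkcond /S2; apply: eq_bigr => i _.
  by rewrite /w2 inE; case: (b <= _).
have S2M : S2 = M%:R - K%:R by rewrite S2E /K (natrB _ (ltnW lb)) subKr.
have VS1 : V <= S1.
  by apply: le_trans KS; rewrite ler_peMl ?ler1n // ltW.
have VS3 : V <= S3.
  by apply: le_trans kS; rewrite ler_peMl ?ler1n // ltW.
have S10 : 0 < S1 by exact: lt_le_trans VS1.
have S30 : 0 < S3 by exact: lt_le_trans VS3.
pose bad1 := bad_order w1 (S1 / 6).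
pose bad2 := bad_order w2 (2 * q ^+ 2).
pose bad3 := bad_order w3 (S3 / 4).
have c1 : #|bad1|%:R <= n`!%:R / 4 :> R.
  apply: bad_order_card; rewrite ?divr_gt0 //.
  apply: le_trans (_ : b * S1 * 4 <= _).
    rewrite ler_wpM2r // mulr_sumr; apply: ler_sum => i _; rewrite /w1.
    by case: ltP => [pb|_]; rewrite ?mulr0 ?expr0n //= expr2 ler_wpM2r // ltW.
  have : b * S1 * 144 <= S1 * S1 by rewrite mulrAC ler_wpM2r ?(ltW S10) // (le_trans b144).
  rewrite expr2; lra.
have c2 : #|bad2|%:R <= n`!%:R / 4 :> R.
  apply: bad_order_card; rewrite ?mulr_gt0 //.
  rewrite exprMn -exprM qm (_ : 2 ^+ 2 = 4) -?natrX // mulrC ler_pM2l //.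
  apply: le_trans (_ : S2 <= _); last by rewrite S2E ler_nat ltnW.
  by apply: ler_sum => i _; rewrite /w2; case: (b <= _); rewrite ?expr1n ?expr0n.
have c3 : #|bad3|%:R <= n`!%:R / 4 :> R.
  apply: bad_order_card; rewrite ?divr_gt0 //.
  apply: le_trans (_ : C * S3 * 4 <= _).
    rewrite ler_wpM2r // mulr_sumr; apply: ler_sum => i _; rewrite /w3.
    by case: ltP => [pb|_]; rewrite ?mulr0 ?expr0n //= expr2 ler_wpM2r // ltW.
  have : C * S3 * 64 <= S3 * S3 by rewrite mulrAC ler_wpM2r ?(ltW S30) //; lra.
  rewrite expr2; lra.
pose good : pred 'S_n := [pred t | [&& ~~ bad1 t, ~~ bad2 t & ~~ bad3 t]].
have good_card : n`!%:R / 4 <= #|good|%:R :> R.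
  have : (n`! <= #|good| + (#|bad1| + #|bad2| + #|bad3|))%N.
    rewrite -card_Sn -(cardC good) leq_add2l.
    apply: leq_trans (_ : _ <= #|[predU [predU bad1 & bad2] & bad3]|)%N _.
      apply: subset_leq_card; apply/fintype.subsetP => t.
      by rewrite !inE !negb_and !negbK orbA.
    have leqU (A B : pred 'S_n) : (#|[predU A & B]| <= #|A| + #|B|)%N.
      by rewrite -cardUI leq_addr.
    by rewrite (leq_trans (leqU _ _)) // leq_add2r leqU.
  rewrite -(ler_nat R) !natrD; lra.
pose e0 := trunc_log 2 k0.
have /andP[e0le e0lt] := trunc_log_bounds (isT : (1 < 2)%N) k00.
have e0j : (e0.+2 < log_size M + 3)%N.
  have : (e0 <= trunc_log 2 M)%N by rewrite leq_trunc_log // leq_subr.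
  rewrite /log_size; clear; lia.
pose j : 'I_(log_size M + 3) := Ordinal e0j.
set k := small_machines M j.
have kE : k = minn (2 ^ e0.+1) M by [].
have k0k : (k0 <= k)%N by rewrite kE leq_min ltnW // leq_subr.
have kk0 : (k <= 2 * k0)%N by rewrite kE geq_min expnS leq_mul2l e0le.
pose G t := [pred om : seed R M |
  (seed_cutoff n om (take n./2 (arrival p t)) == C) && (om.2 == j)].
have s_ge0 t i : 0 <= tnth (arrival p t) i by rewrite tnth_mktuple.
have sample_sum (w : R -> R) (t : 'S_n) (Q : pred R) :
    \sum_(i < n | (i < n./2)%N) (if Q (tnth p (t i)) then w (tnth p (t i)) else 0) =
    \sum_(i < n | (i < n./2)%N && Q (tnth (arrival p t) i)) w (tnth (arrival p t) i).
  rewrite big_mkcondr; apply: eq_bigr => i _; by rewrite tnth_mktuple.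
apply: le_trans (_ : #|good|%:R * ((Num.truncn q)%:R * C) / (n`!%:R * #|seed R M|%:R) <= _).
  have nf : 0 < n`!%:R :> R by rewrite ltr0n fact_gt0.
  have gC : 0 <= (Num.truncn q)%:R * C by rewrite mulr_ge0 // ltW.
  have Nf : 0 < #|seed R M|%:R :> R.
    by rewrite ltr0n; apply/card_gt0P; exists (ord0, inord 0, j).
  have -> : (Num.truncn q)%:R * C / (4 * #|seed R M|%:R) =
      n`!%:R / 4 * ((Num.truncn q)%:R * C) / (n`!%:R * #|seed R M|%:R).
    by field; rewrite !gt_eqF.
  by rewrite ler_wpM2r ?invr_ge0 ?mulr_ge0 ?ler0n // ler_wpM2r.
apply: (rom_value_ge p_ge0 (G := G)); first exact: ltW.
- move=> t /and3P[/(good_order_lt _) B1 /(good_order_lt _) B2 _].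
  have /andP[D1 _] := B1 ltac:(by rewrite divr_gt0).
  have /andP[D2 D3] := B2 ltac:(by rewrite mulr_gt0).
  have v1 := sample_sum id t (fun x => x < b).
  have v2 := sample_sum (fun=> 1) t (fun x => b <= x).
  have dev1 : deviation w1 t = \sum_(i < n | (i < n./2)%N) w1 (t i) - th * S1 by [].
  have dev2 : deviation w2 t = \sum_(i < n | (i < n./2)%N) w2 (t i) - th * S2 by [].
  have th1 : 1 / 3 * S1 <= th * S1 by rewrite ler_wpM2r ?(ltW S10).
  have volE : \sum_(i < n | (i < n./2)%N && (tnth (arrival p t) i < b)) tnth (arrival p t) i =
      \sum_(i < n | (i < n./2)%N) w1 (t i) by rewrite -v1.
  have cntE : #|[pred i : 'I_n | (i < n./2)%N && (b <= tnth (arrival p t) i)%R]|%:R =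
      \sum_(i < n | (i < n./2)%N) w2 (t i).
    rewrite -sum1_card natr_sum -v2; apply: eq_bigr => i _.
    by rewrite /w2; case: (b <= _).
  apply: (@good_order_seeds _ _ _ (arrival p t) V q K) => //.
  + by rewrite volE; lra.
  + apply: le_trans vol; rewrite volE.
    apply: le_trans (_ : \sum_i w1 (t i) <= _).
      rewrite [leRHS](bigID (fun i : 'I_n => (i < n./2)%N)) /= ler_wpDr //.
      by apply: sumr_ge0.
    rewrite (_ : \sum_i w1 (t i) = S1); last first.
      by rewrite /S1 [RHS](reindex_inj (@perm_inj _ t)).
    apply: ler_sum => i _.
    rewrite le_min /w1; case: ltP => pb; rewrite ?lexx ?p_ge0 ?ltW //=.
    by apply: lt_le_trans pb bV.
  + by rewrite cntE -S2M -/th; lra.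
  + by rewrite cntE -S2M -/th; lra.
- move=> t om a /and3P[_ _ /(good_order_lt _) B3] /andP[/eqP cE /eqP jE] fol.
  have /andP[D1 _] := B3 ltac:(by rewrite divr_gt0).
  rewrite -cE; apply: (run_split (s_ge0 t) fol); rewrite ?jE -?/k ?cE //.
  + by rewrite (leq_trans k00 k0k) kE geq_minr.
  + rewrite (arrival_card p t (fun x => C <= x)).
    by apply: leq_trans (leq_sub2l _ k0k) _; rewrite /k0 subKn // ltnW.
  + have v3 := sample_sum id t (fun x => x < C).
    have dev3 : deviation w3 t = \sum_(i < n | (i < n./2)%N) w3 (t i) - th * S3 by [].
    have th1 : th * S3 <= 1 / 2 * S3 by rewrite ler_wpM2r // ltW.
    have split3 : S3 = \sum_(i < n | (i < n./2)%N) w3 (t i) +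
        \sum_(i < n | (n./2 <= i)%N && (tnth (arrival p t) i < C)) tnth (arrival p t) i.
      rewrite /S3 /w3 -big_mkcond -(arrival_sum p t (fun x => x < C) id).
      rewrite (bigID (fun i : 'I_n => (i < n./2)%N)) /=; congr (_ + _).
        by rewrite v3; apply: eq_bigl => i; rewrite andbC.
      by apply: eq_bigl => i; rewrite andbC -leqNgt.
    have kC : k%:R * C <= 2 * k0%:R * C by rewrite ler_wpM2r ?(ltW C0) // -natrM ler_nat.
    have kCV : k0%:R * C <= k0%:R * (V / 64) by rewrite ler_wpM2l.
    lra.
Qed.
End Main.

Lemma covering_rom_ge (R : realType) (m n : nat) (p : n.-tuple R) (q c : R) :
  64 * 88 <= c ->
  (forall i, 0 <= tnth p i) -> (2 <= m.+1)%N -> 0 < OPT m.+1 p ->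
  1 <= q -> q ^+ 4 = m.+1%:R ->
  OPT m.+1 p * expR (-1) /
    (c * q * (log_size m.+1 + 10)%:R * (log_size m.+1 + 3)%:R)
  <= rom_value (@covering_alg R) m.+1 p.
Proof.
move=> hc p0 m2 V0 q1 qm.
have c144 : 144 <= c by move: hc; clear; lra.
have c0 : 0 < c by exact: lt_le_trans c144.
set M := m.+1; set V := OPT M p; set A := (log_size M + 10)%:R; set B := (log_size M + 3)%:R.
have q0 : 0 < q by exact: lt_le_trans q1.
have e0 : 0 < expR (-1) :> R by exact: expR_gt0.
have e1 : expR (-1) <= 1 :> R by rewrite -[leRHS]expR0 ler_expR lerN10.
have A1 : 1 <= A by rewrite ler1n addnC.
have B0 : 0 < B by rewrite ltr0n addnC.
have A0 : 0 < A by exact: lt_le_trans A1.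
have s0 t i : 0 <= tnth (arrival p t) i by rewrite tnth_mktuple.
have Ve : V * expR (-1) <= V by rewrite ler_piMr // ltW.
have Ve0 : 0 < V * expR (-1) by exact: mulr_gt0.
have greedy v : V * expR (-1) / (144 * q) <= v -> (forall t (om : seed R M) (a : n.-tuple 'I_M),
     small_machines M om.2 = 0%N ->
     follows (@dest R m n) om (zip (arrival p t) a) -> v <= minload (arrival p t) a) ->
    V * expR (-1) / (c * q * A * B) <= rom_value (@covering_alg R) M p.
  move=> vge vP; apply: le_trans (pure_greedy_rom p0 _ vP); last first.
    by apply: le_trans vge; rewrite divr_ge0 ?mulr_ge0 // ltW.
  rewrite invfM mulrA ler_wpM2r ?invr_ge0 ?(ltW B0) //; apply: le_trans vge.
  rewrite ler_wpM2l ?(ltW Ve0) // lef_pV2 ?posrE ?mulr_gt0 //.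
  apply: le_trans (_ : c * q <= _); first by rewrite ler_wpM2r ?(ltW q0).
  by rewrite ler_peMr // ltW // mulr_gt0.
have [|lb] := leqP M #|[pred i | (V / (144 * q) <= tnth p i)%R]|.
  move=> H; apply: (greedy (V / (144 * q))) => [|t om a k0 fol].
    by rewrite ler_wpM2r // invr_ge0 mulr_ge0 // ltW.
  apply: (run_all_large (s0 t) fol) => //; first by rewrite divr_gt0 ?mulr_gt0.
  by rewrite (arrival_card p t (fun x => V / (144 * q) <= x)).
have [C0 CV VC] := C_bounds V0; rewrite -/M -/V in C0 CV VC.
set C := expR (Num.floor (ln (V / 64)))%:~R in C0 CV VC.
have [|lC] := leqP M #|[pred i | (C <= tnth p i)%R]|.
  move=> H; apply: (greedy C) => [|t om a k0 fol].
    apply: le_trans VC; rewrite [leRHS]mulrAC ler_wpM2l ?(ltW Ve0) //.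
    by rewrite lef_pV2 ?posrE ?mulr_gt0 //; lra.
  apply: (run_all_large (s0 t) fol) => //.
  by rewrite (arrival_card p t (fun x => C <= x)).
have [|vol] := leP (M%:R * (V * 2)) (\sum_i Num.min (tnth p i) V).
  move=> H; apply: (greedy V) => [|t om a k0 fol].
    by rewrite ler_pdivrMr ?mulr_gt0 // (le_trans Ve) // ler_peMr ?(ltW V0) //; lra.
  apply: (run_all_volume (s0 t) fol) => //; first exact: ltW.
  by rewrite (arrival_sum p t predT (fun x => Num.min x V)).
apply: le_trans (good_rom p0 m2 V0 q1 qm lb lC (ltW vol)); rewrite -/C.
rewrite seed_card !natrM -/A -/B.
set g := (Num.truncn q)%:R; set E := _.*2.+1%:R.
have g2 : q <= 2 * g.
  have g1 : 1 <= g by rewrite ler1n truncn_gt0.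
  have := truncnS_gt q; rewrite -natr1 -/g; lra.
have Q1 : 1 <= q ^+ 2 by rewrite exprn_ege1.
have E11 : E <= 11 * (q * q).
  have odd_natr k : k.*2.+1%:R = 2 * k%:R + 1 :> R.
    by rewrite -addn1 natrD -muln2 natrM mulrC.
  have sqrtM : Num.sqrt M%:R = q ^+ 2 by rewrite -qm (exprM q 2 2) sqrtr_sqr ger0_norm ?sqr_ge0.
  rewrite /E odd_natr /half_window sqrtM -[in leLHS]natr1 -expr2.
  have : (Num.truncn (4 * q ^+ 2))%:R <= 4 * q ^+ 2 by rewrite truncn_le mulr_ge0 // sqr_ge0.
  move: Q1; clear; lra.
have E0 : 0 < E by rewrite ltr0n.
apply: le_trans (_ : (q / 2) * (V / 64 * expR (-1)) / (4 * (11 * (q * q) * A * B)) <= _).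
  apply: le_trans (_ : V * expR (-1) / (64 * 88 * q * A * B) <= _).
    rewrite ler_wpM2l ?(ltW Ve0) // lef_pV2 ?posrE ?mulr_gt0 //.
    by do 3 (rewrite ler_wpM2r ?(ltW A0) ?(ltW B0) ?(ltW q0) //).
  rewrite le_eqVlt; apply/orP; left; apply/eqP; field.
  by rewrite !gt_eqF.
apply: ler_pM.
- by rewrite mulr_ge0 ?divr_ge0 ?mulr_ge0 // ltW.
- by rewrite invr_ge0 !mulr_ge0 // ltW.
- by apply: ler_pM; rewrite ?divr_ge0 ?mulr_ge0 ?(ltW q0) ?(ltW V0) ?(ltW e0) //; lra.
rewrite lef_pV2 ?posrE ?mulr_gt0 // ler_pM2l //.
by rewrite ler_wpM2r ?(ltW B0) // ler_wpM2r ?(ltW A0).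
Qed.

Theorem theorem1 (R : realType) :
  exists A : online_alg R, valid_alg A /\
    exists (C : R) (k : nat), 0 < C /\
      forall m : nat, (2 <= m)%N ->
        (rom_comp_ratio A m <=
         (C * (m%:R `^ (4%:R^-1)) * (ln (m%:R : R)) ^+ k)%:E)%E.
Proof.
exists (@covering_alg R); split; first exact: covering_alg_valid.
have ln2 : 0 < ln 2 :> R by rewrite ln_gt0 // ltr1n.
have [c hc] : exists c : R, 64 * 88 <= c by exists (64 * 88).
have c1 : 1 <= c by move: hc; clear; lra.
have c0 : 0 < c by exact: lt_le_trans c1.
pose D : R := c / expR (-1) * 60.
have e0 : 0 < expR (-1) :> R by exact: expR_gt0.
have e1 : expR (-1) <= 1 :> R by rewrite -[leRHS]expR0 ler_expR lerN10.
have D1 : 1 <= D.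
  by rewrite /D mulrAC ler_pdivlMr // mul1r (le_trans e1) //; move: c1; clear; lra.
have D0 : 0 < D by exact: lt_le_trans D1.
exists (D / ln 2 ^+ 2), 2%N; split; first by rewrite divr_gt0 ?exprn_gt0.
move=> [//|m] m2; set M := m.+1; set q := M%:R `^ _.
have M0 : 0 <= M%:R :> R by [].
have q1 : 1 <= q.
  have -> : 1 = 1 `^ (4%:R^-1) :> R by rewrite powR1.
  apply: ge0_ler_powR; rewrite ?nnegrE ?invr_ge0 //.
  by rewrite ler1n.
have qm : q ^+ 4 = M%:R.
  by rewrite -powR_mulrn ?powR_ge0 // -powRrM mulVf ?powRr1.
have q0 : 0 < q by exact: lt_le_trans q1.
have M1 : (0 < M)%N by [].
pose tl : nat := trunc_log 2 M.
have tl1 : 1 <= tl%:R :> R by rewrite ler1n trunc_log_gt0.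
have tl_ln : tl%:R <= ln M%:R / ln 2 :> R.
  rewrite ler_pdivlMr // mulr_natl -lnXn // ler_ln ?posrE ?exprn_gt0 ?ltr0n //.
  by rewrite -natrX ler_nat; exact: trunc_logP.
have bound1 : D * (tl%:R ^+ 2) <= D / ln 2 ^+ 2 * ln M%:R ^+ 2.
  rewrite -mulrA [_^-1 * _]mulrC -expr_div_n ler_wpM2l ?(ltW D0) //.
  by rewrite ler_pXn2r ?nnegrE // (le_trans _ tl_ln).
set U := D / ln 2 ^+ 2 * q * _.
have UE : q * (D * tl%:R ^+ 2) <= U.
  by rewrite /U [leRHS]mulrAC [leRHS]mulrC ler_wpM2l ?(ltW q0).
have tl2 : 1 <= tl%:R ^+ 2 :> R by rewrite exprn_ege1.
have U1 : 1 <= U.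
  by apply: le_trans UE; rewrite mulr_ege1 // mulr_ege1.
apply: ge_ereal_sup => _ [n [p [p0 ->]]]; rewrite /Defs.ratio.
have [V0|V0] := eqVneq (OPT M p) 0.
  rewrite V0 mul0r; case: (rom_value _ M p == 0); rewrite lee_fin //.
  exact: le_trans U1.
have Vpos : 0 < OPT M p by rewrite lt0r V0 OPT_ge0.
have := covering_rom_ge hc p0 m2 Vpos q1 qm; rewrite -/M.
set r := rom_value _ _ _; set X := _ * expR (-1) / _ => Xr.
have X0 : 0 < X by rewrite divr_gt0 ?mulr_gt0 ?ltr0n // addnC.
have r0 : 0 < r by exact: lt_le_trans Xr.
rewrite gt_eqF // lee_fin ler_pdivrMr //.
have QD0 : 0 <= q * (D * tl%:R ^+ 2) by rewrite mulr_ge0 ?(ltW q0) // mulr_ge0 ?(ltW D0) // sqr_ge0.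
apply: le_trans (ler_pM QD0 (ltW X0) UE Xr).
rewrite /X /D.
have L10 : (log_size M + 10)%:R <= 12 * tl%:R :> R.
  by rewrite /log_size -/tl natrD -natr1; lra.
have L3 : (log_size M + 3)%:R <= 5 * tl%:R :> R.
  by rewrite /log_size -/tl natrD -natr1; lra.
have LL : (log_size M + 10)%:R * (log_size M + 3)%:R <= 60 * tl%:R ^+ 2 :> R.
  rewrite (_ : 60 * _ = (12 * tl%:R) * (5 * tl%:R)); last by ring.
  by rewrite ler_pM.
set a := (log_size M + 10)%:R in LL *; set b := (log_size M + 3)%:R in LL *.
have a0 : 0 < a by rewrite ltr0n addnC.
have b0 : 0 < b by rewrite ltr0n addnC.
have -> : q * (c / expR (-1) * 60 * tl%:R ^+ 2) *
    (OPT M p * expR (-1) / (c * q * a * b)) =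
    OPT M p * ((60 * tl%:R ^+ 2) / (a * b)).
  by field; rewrite !gt_eqF.
by rewrite ler_peMr ?(ltW Vpos) // ler_pdivlMr ?mulr_gt0 // mul1r.
Qed.
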